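(* There exist absolute constants $c_1,c_2>0$ such that the following holds. Let $K\ge 1$ and let $\theta(\cdot):\mathbf{R}^K_+\to\mathbf{R}$ be a convex, continuous function which is positively homogeneous of degree 1, monotone on $\mathbf{R}^K_+$ (that is, $0\le t\le t'$ implies $\theta(t)\le\theta(t')$), and positive outside of the origin. Let $\varkappa\ge 1$, $\varsigma\ge 1$, and let $\|\cdot\|_i$ be $(\varkappa,\varsigma)$-regular norms on $\mathbf{R}^{n_i}$, $1\le i\le K$. Then the aggregated norm $$\|[x_1;\ldots;x_K]\|=\theta^{1/2}\big(\|x_1\|_1^2,\ldots,\|x_K\|_K^2\big),\qquad x_i\in\mathbf{R}^{n_i},$$ on $\mathbf{R}^{n_1+\cdots+n_K}$ (this indeed is a norm) is $(c_1[\ln(K+1)+\varkappa],\,c_2\varsigma)$-regular.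
   Context: For reals $\varkappa\ge 1$, a norm $\mathfrak{n}(\cdot)$ on $\mathbf{R}^n$ is called $\varkappa$-smooth if the function $\Phi(x)=\mathfrak{n}^2(x)$ is continuously differentiable and $\Phi(x+h)\le\Phi(x)+[\Phi'(x)]^Th+\varkappa\Phi(h)$ for all $x,h\in\mathbf{R}^n$. For reals $\varkappa\ge1,\varsigma\ge1$, a norm $\|\cdot\|$ on $\mathbf{R}^n$ is called $(\varkappa,\varsigma)$-regular if there exists a $\varkappa$-smooth norm $\mathfrak{n}(\cdot)$ on $\mathbf{R}^n$ such that $\varsigma^{-1}\mathfrak{n}(x)\le\|x\|\le\varsigma\,\mathfrak{n}(x)$ for all $x$. Here $\mathbf{R}^K_+$ is the nonnegative orthant, inequalities between vectors are entrywise, and $[x_1;\ldots;x_K]$ denotes vertical concatenation of vectors. ''Absolute constants'' do not depend on any of the data ($K$, $\theta$, $n_i$, the norms, $\varkappa$, $\varsigma$). Each $\|\cdot\|_i$ here is an arbitrary given norm (the index $i$ does not denote an $\ell_i$-norm). *)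

(* Defs.v *)
From mathcomp Require Import all_boot all_order all_algebra.
From mathcomp Require Import boolp classical_sets functions reals.
From mathcomp Require Import topology normedtype derive exp convex.

Set Implicit Arguments.
Unset Strict Implicit.
Unset Printing Implicit Defensive.

Import Order.TTheory GRing.Theory Num.Theory.
Import numFieldNormedType.Exports.

Local Open Scope classical_set_scope.
Local Open Scope ring_scope.

Section Norms.
Variables (R : realType) (n : nat).
Implicit Types (N f : 'cV[R]_n -> R) (x h : 'cV[R]_n).

(* The axioms are those of the factory [Lmodule_isNormed]; nonnegativity
   follows from them.  Norms are plain functions here because the statements
   below involve several norms on the same space. *)
Definition is_norm N : Prop :=
  [/\ forall x y, N (x + y) <= N x + N y,
      forall (a : R) x, N (a *: x) = `|a| * N x
    & forall x, N x = 0 -> x = 0].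

Definition gradient f x : 'cV[R]_n := \col_i 'd f x (delta_mx i 0).

Definition continuously_differentiable f : Prop :=
  (forall x, differentiable f x) /\ continuous (gradient f).

Definition smooth_norm (kappa : R) N : Prop :=
  let Phi x := N x ^+ 2 in
  [/\ 1 <= kappa, is_norm N, continuously_differentiable Phi
    & forall x h,
        Phi (x + h) <=
          Phi x + ((gradient Phi x)^T *m h) 0 0 + kappa * Phi h].

Definition regular_norm (kappa sigma : R) N : Prop :=
  [/\ 1 <= kappa, 1 <= sigma, is_norm N
    & exists2 M : 'cV[R]_n -> R, smooth_norm kappa M
        & forall x, sigma^-1 * M x <= N x <= sigma * M x].

End Norms.

Section Aggregation.
Variables (R : realType) (K : nat).

Definition orthant : set 'cV[R]_K := [set t | forall i, 0 <= t i 0].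

(* The values of [theta] outside of the orthant are irrelevant. *)
Record aggregator (theta : 'cV[R]_K -> R) : Prop := Aggregator {
  aggregator_convex : convex_function orthant theta;
  aggregator_continuous : {within orthant, continuous theta};
  aggregator_homogeneous : forall (a : R) (t : 'cV[R]_K),
    0 < a -> orthant t -> theta (a *: t) = a * theta t;
  aggregator_monotone : forall t t' : 'cV[R]_K,
    orthant t -> (forall i, t i 0 <= t' i 0) ->
    theta t <= theta t';
  aggregator_positive : forall t : 'cV[R]_K,
    orthant t -> t <> 0 -> 0 < theta t }.

Definition aggregated_norm (theta : 'cV[R]_K -> R) (n : 'I_K -> nat)
    (N : forall i, 'cV[R]_(n i) -> R) (x : 'cV[R]_(\sum_i n i)) : R :=
  Num.sqrt (theta (\col_i N i (submxcol x i) ^+ 2)).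

End Aggregation.

(* Main.v *)
From HB Require Import structures.
Require Import Defs.
From mathcomp Require Import all_boot all_order all_algebra.
From mathcomp Require Import unstable boolp classical_sets functions reals.
From mathcomp Require Import topology normedtype landau derive exp convex.
From mathcomp Require Import interval_inference ring lra.

(** The aggregator theta is the maximum of the linear forms in a compact convex
    set S of nonnegative vectors ([dual_set], [dual_set_attained]).  If the
    norms M_i are kappa-smooth, then the squared norm theta (M_i (x_i) ^ 2) is a
    maximum of sums of s_i M_i (x_i) ^ 2 over s in S; each sum is kappa-smooth,
    and smoothness of the maximum can only fail because the maximizer jumps.
    So S is replaced by a set of weights that is comparable to S and so strongly
    curved that the maximizer moves in a controlled way.

    With a_i the maximum of s_i over S, the new weights are
    a_i f (s_i / a_i + 1 / K), where f r = r (2 - ln r / L) and L = ln (K + 1)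
    ([twist], [weight]).  The shift by 1 / K keeps the logarithm within [-L, L],
    so that the weights lie between s_i and 3 (s_i + a_i / K), and the new
    maximum F lies between theta and 6 theta ([pairing_le_weight],
    [weight_le]).  Concavity of f gives a quadratic gain: if lam and lam' are
    the optimal weights for t and t', then
      sum_i lam'_i t_i
        + (100 L)^-1 sum_i (lam_i - lam'_i)^2 / (lam_i + lam'_i) t_i
    is at most F t ([gauge_smoothing]).

    Take t and t' to be the vectors of squared block norms of x and x + h.
    Smoothness of each block gives an upper bound for F t' with weights lam'; in
    the linear term lam' is replaced by lam, at a cost that the quadratic gain
    compensates up to 200 L F at the squared block norms of h
    ([aggregated_norm_smooth]).  This yields the upper quadratic bound with
    constant kappa + 200 ln (K + 1).  For a norm, such a bound at every point
    already forces continuous differentiability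
    ([smooth_norm_of_upper_quadratic]).  Finally theta <= F <= 9 theta, so
    that passing from theta and the given norms to F and the M_i changes the
    aggregated norm by a factor of at most 3 sigma. *)

Set Implicit Arguments.
Unset Strict Implicit.
Unset Printing Implicit Defensive.

Import Order.TTheory GRing.Theory Num.Theory.
Import numFieldNormedType.Exports.

Local Open Scope ring_scope.

(** * Sublinear functions and supporting linear forms *)

Definition sublinear (R : realType) (V : lmodType R) (p : V -> R) : Prop :=
  (forall x y, p (x + y) <= p x + p y) /\
  (forall (a : R) x, 0 < a -> p (a *: x) = a * p x).

Section HahnBanach.
Variables (R : realType) (V : lmodType R).
Implicit Types (p q : V -> R) (u v x y : V).

Lemma sublinear0 p : sublinear p -> p 0 = 0.
Proof. by case=> _ /(_ 2 0 (ltr0Sn _ _)); rewrite scaler0; lra. Qed.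

Lemma sublinear_opp p x : sublinear p -> - p (- x) <= p x.
Proof.
move=> sp; have := sp.1 x (- x); rewrite subrr (sublinear0 sp); lra.
Qed.

(** On a direction along which p is linear, every sublinear q below p is
    squeezed to p: linearity already achieved survives further decreasing. *)
Lemma sublinear_odd_le p q v : sublinear q -> (forall x, q x <= p x) ->
  p (- v) = - p v -> q v = p v.
Proof.
move=> sq qp pv; apply/eqP; rewrite eq_le qp /=.
by have := sublinear_opp v sq; have := qp (- v); rewrite pv; lra.
Qed.

(** One step of the Hahn-Banach argument: the infimum over l >= 0 of
    p (x + l v) - l p v is the largest sublinear function below p that is
    linear along v with slope p v. *)
Lemma sublinear_odd_along p v : sublinear p ->
  exists q,
    [/\ sublinear q, forall x, q x <= p x, q v = p v & q (- v) = - q v].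
Proof.
move=> sp; have [pD pZ] := sp.
pose f x (l : R) := p (x + l *: v) - l * p v.
pose A x : set R := [set f x l | l in [set l | 0 <= l]]%classic.
pose q x := inf (A x).
have A0 x : (A x !=set0)%classic by exists (f x 0), 0 => /=.
have lbA x : lbound (A x) (- p (- x)).
  move=> _ [l /= l0 <-]; rewrite /f.
  have -> : l * p v = p (l *: v).
    move: l0; rewrite le_eqVlt => /predU1P[<-|/pZ ->//].
    by rewrite scale0r mul0r (sublinear0 sp).
  have := pD (x + l *: v) (- x); rewrite addrAC subrr add0r; lra.
have hA x : has_inf (A x) by split=> //; exists (- p (- x)); exact: lbA.
have qle x (l : R) : 0 <= l -> q x <= f x l.
  by move=> l0; apply: ge_inf; [exact: (hA x).2 | exists l].
have qp x : q x <= p x.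
  by apply: le_trans (qle x 0 (lexx _)) _; rewrite /f scale0r addr0 mul0r subr0.
have qge x (c : R) : (forall l : R, 0 <= l -> c <= f x l) -> c <= q x.
  by move=> H; apply: lb_le_inf => // _ [l /= l0 <-]; exact: H.
have sq : sublinear q.
  split=> [x y|a x a0].
    rewrite -lerBlDr; apply: (qge) => l l0; rewrite lerBlDr -lerBlDl.
    apply: (qge) => m m0; rewrite lerBlDr.
    apply: le_trans (qle (x + y) (l + m) (addr_ge0 l0 m0)) _.
    rewrite /f scalerDl addrACA.
    by have := pD (x + l *: v) (y + m *: v); lra.
  have fZ y (c l : R) : 0 < c -> f (c *: y) (c * l) = c * f y l.
    by move=> c0; rewrite /f -scalerA -scalerDr pZ //; ring.
  apply/eqP; rewrite eq_le; apply/andP; split.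
    rewrite -ler_pdivrMl //; apply: (qge) => l l0.
    rewrite ler_pdivrMl // -fZ //.
    by apply: qle; rewrite mulr_ge0 // ltW.
  apply: (qge) => l l0.
  have -> : l = a * (a^-1 * l) by rewrite mulVKf // gt_eqF.
  rewrite fZ // ler_pM2l //; apply: qle.
  by rewrite mulr_ge0 // invr_ge0 ltW.
suff [qv qNv] : q v = p v /\ q (- v) = - q v by exists q.
(* The choice l = 1 in the infimum that defines q (- v). *)
have h : q (- v) <= - p v.
  apply: le_trans (qle _ 1 ler01) _.
  by rewrite /f scale1r addNr (sublinear0 sp) mul1r sub0r.
by have := sublinear_opp v sq; have := qp v; split; lra.
Qed.

Lemma sublinear_odd_on p (vs : seq V) : sublinear p ->
  exists q, [/\ sublinear q, forall x, q x <= p x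
    & forall v, v \in vs -> q (- v) = - q v].
Proof.
move=> sp; elim: vs => [|v vs [q [sq qp qvs]]]; first by exists p.
have [r [sr rq _ rv]] := sublinear_odd_along v sq.
exists r; split=> // [x|u]; first exact: le_trans (rq x) (qp x).
rewrite inE => /predU1P[->//|uvs].
have qu := qvs u uvs; rewrite (sublinear_odd_le sr rq qu).
by rewrite (sublinear_odd_le sr rq) ?opprK ?qu ?opprK.
Qed.

End HahnBanach.

Section Pairing.
Variables (R : realType) (K : nat).
Implicit Types (s : 'rV[R]_K) (t u : 'cV[R]_K).

Definition pairing (s : 'rV[R]_K) (t : 'cV[R]_K) : R := \sum_i s 0 i * t i 0.

Lemma pairingDr s t u : pairing s (t + u) = pairing s t + pairing s u.
Proof. by rewrite -big_split; apply: eq_bigr => i _; rewrite mxE mulrDr. Qed.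

Lemma pairingZr s (a : R) t : pairing s (a *: t) = a * pairing s t.
Proof. by rewrite mulr_sumr; apply: eq_bigr => i _; rewrite mxE mulrCA. Qed.

Lemma sublinear_sum (p : 'cV[R]_K -> R) (I : finType) (f : I -> 'cV[R]_K) :
  sublinear p -> p (\sum_i f i) <= \sum_i p (f i).
Proof.
move=> sp; apply: (big_ind2 (fun u x => p u <= x)) => // [|u x v y ux vy].
  by rewrite sublinear0.
exact: le_trans (sp.1 u v) (lerD ux vy).
Qed.

(** Linearizing first along t0 fixes the value p t0; linearizing then along the
    coordinate directions leaves a linear functional below p. *)
Lemma sublinear_support (p : 'cV[R]_K -> R) (t0 : 'cV[R]_K) : sublinear p ->
  exists s : 'rV[R]_K,
    (forall t, pairing s t <= p t) /\ pairing s t0 = p t0.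
Proof.
move=> sp.
have [p1 [sp1 p1p p1t0 p1odd]] := sublinear_odd_along t0 sp.
have [q [sq qp1 qodd]] := sublinear_odd_on [seq delta_mx i 0 | i : 'I_K] sp1.
have qe i : q (- delta_mx i 0) = - q (delta_mx i 0).
  by apply: qodd; apply/mapP; exists i; rewrite ?mem_enum.
pose s : 'rV[R]_K := \row_i q (delta_mx i 0).
have colE (t : 'cV[R]_K) : t = \sum_i t i 0 *: delta_mx i 0.
  rewrite {1}(matrix_sum_delta t); apply: eq_bigr => i _.
  by rewrite big_ord1.
have qZe (a : R) i : q (a *: delta_mx i 0) = a * q (delta_mx i 0).
  have [a0|a0|->] := ltgtP a 0; last by rewrite scale0r mul0r sublinear0.
    have := sq.2 (- a) (- delta_mx i 0); rewrite oppr_gt0 => /(_ a0).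
    by rewrite qe scalerN scaleNr opprK mulrNN.
  exact: sq.2.
have qs t : q t <= pairing s t.
  rewrite {1}(colE t); apply: le_trans (sublinear_sum _ sq) _.
  by apply: ler_sum => i _; rewrite qZe mxE mulrC.
have sN t : pairing s (- t) = - pairing s t.
  by rewrite /pairing -sumrN; apply: eq_bigr => i _; rewrite !mxE mulrN.
(* Both sides are odd along every direction, so the bound is an equality. *)
have sq_eq t : pairing s t = q t.
  apply/eqP; rewrite eq_le qs andbT -lerN2 -sN.
  by apply: le_trans (qs (- t)); have := sublinear_opp t sq; lra.
exists s; split=> [t|]; rewrite sq_eq; first exact: le_trans (qp1 t) (p1p t).
by rewrite (sublinear_odd_le sq qp1 p1odd).
Qed.

End Pairing.

(** * Gauges on the orthant and their dual sets *)

(** The part of being an aggregator that makes [aggregated_norm] a norm, in a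
    form shared by an aggregator and its smoothed version. *)
Record gauge (R : realType) (K : nat) (theta : 'cV[R]_K -> R) : Prop := Gauge {
  gauge_subadditive : forall t u, orthant t -> orthant u ->
    theta (t + u) <= theta t + theta u;
  gauge_homogeneous : forall (a : R) t, 0 < a -> orthant t ->
    theta (a *: t) = a * theta t;
  gauge_monotone : forall t u : 'cV[R]_K, orthant t ->
    (forall i, t i 0 <= u i 0) -> theta t <= theta u;
  gauge_positive : forall t : 'cV[R]_K, orthant t -> t <> 0 -> 0 < theta t }.

Lemma continuous_sum_at (R : realType) (T : topologicalType) (I : finType)
    (f : I -> T -> R) (x : T) :
  (forall i, {for x, continuous (f i)}) ->
  {for x, continuous (fun y => \sum_i f i y)}.
Proof.
move=> cf; apply: (@cvg_big _ _ +%R 0 predT); first exact: add_continuous.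
by move=> i _; exact: cf.
Qed.

Section Gauge.
Variables (R : realType) (K : nat).
Implicit Types (theta : 'cV[R]_K -> R) (t u : 'cV[R]_K) (s : 'rV[R]_K).

Lemma orthantD t u : orthant t -> orthant u -> orthant (t + u).
Proof. by move=> t0 u0 i; rewrite mxE addr_ge0. Qed.

Lemma orthantZ (a : R) t : 0 <= a -> orthant t -> orthant (a *: t).
Proof. by move=> a0 t0 i; rewrite mxE mulr_ge0. Qed.

Lemma orthant_delta i : orthant (delta_mx i 0 : 'cV[R]_K).
Proof. by move=> j; rewrite mxE ler0n. Qed.

Lemma orthant0 : orthant (0 : 'cV[R]_K).
Proof. by move=> i; rewrite mxE. Qed.

(** Subadditivity is convexity at the midpoint of 2 t and 2 u. *)
Lemma aggregator_gauge theta : aggregator theta -> gauge theta.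
Proof.
case=> cvx _ hom mono pos; split=> // t u t0 u0.
have h01 : 0 <= 2^-1 :> R by rewrite invr_ge0 ler0n.
have h11 : 2^-1 <= 1 :> R by rewrite invf_le1 ?ltr0n // ler1n.
have := cvx (Itv01 h01 h11) (2 *: t) (2 *: u).
have h2 v : orthant v -> 2 *: v \in @orthant R K.
  by move=> v0; rewrite inE; exact: orthantZ.
move=> /(_ (h2 t t0) (h2 u u0)).
rewrite convRE /= !hom // => h.
have hE : 2^-1 *: (2 *: t) + (1 - 2^-1) *: (2 *: u) = t + u.
  by rewrite !scalerA mulrBl mulVf ?pnatr_eq0 // mul1r scale1r addrK scale1r.
rewrite -hE; apply: le_trans h _; rewrite /onem; lra.
Qed.

Variable theta : 'cV[R]_K -> R.
Hypothesis gT : gauge theta.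

Lemma gauge0 : theta 0 = 0.
Proof.
by have := gauge_homogeneous gT (ltr0Sn R 1) orthant0; rewrite scaler0; lra.
Qed.

Lemma gauge_ge0 t : orthant t -> 0 <= theta t.
Proof.
move=> t0; rewrite -gauge0; apply: (gauge_monotone gT orthant0) => i.
by rewrite mxE.
Qed.

Lemma gauge_eq0 t : orthant t -> theta t = 0 -> t = 0.
Proof.
by move=> t0 h; apply: contrapT => /(gauge_positive gT t0); rewrite h ltxx.
Qed.

Lemma gauge_homogeneous_ge0 (a : R) t : 0 <= a -> orthant t ->
  theta (a *: t) = a * theta t.
Proof.
rewrite le_eqVlt => /predU1P[<- _|]; first by rewrite scale0r gauge0 mul0r.
exact: gauge_homogeneous.
Qed.

Lemma gauge_delta_gt0 i : 0 < theta (delta_mx i 0).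
Proof.
apply: (gauge_positive gT (orthant_delta i)) => /matrixP/(_ i 0).
by rewrite !mxE !eqxx => /eqP; rewrite oner_eq0.
Qed.

Definition dual_set : set 'rV[R]_K :=
  [set s : 'rV[R]_K | (forall i, 0 <= s 0 i) /\
           forall t, orthant t -> pairing s t <= theta t]%classic.

Lemma pairing_delta s i : pairing s (delta_mx i 0) = s 0 i.
Proof.
rewrite /pairing (bigD1 i) //= big1 ?addr0 ?mxE ?eqxx ?mulr1 // => j ji.
by rewrite mxE (negbTE ji) mulr0.
Qed.

Lemma dual_set_le s i : dual_set s -> s 0 i <= theta (delta_mx i 0).
Proof.
by case=> _ /(_ _ (orthant_delta i)); rewrite pairing_delta.
Qed.

(** A gauge is the maximum of the linear forms below it.  Extended to the whole
    space through the positive part of the argument, it is sublinear, and a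
    linear form below that extension has nonnegative coefficients because the
    extension vanishes on the negatives of the basis vectors. *)
Lemma dual_set_attained t : orthant t ->
  exists2 s, dual_set s & pairing s t = theta t.
Proof.
move=> t0; pose pos u : 'cV[R]_K := \col_i Num.max 0 (u i 0).
have pos0 u : orthant (pos u) by move=> i; rewrite mxE le_max lexx.
have posE u : orthant u -> pos u = u.
  by move=> u0; apply/colP => i; rewrite mxE max_r.
have sp : sublinear (theta \o pos).
  split=> [u v|a u a0] /=.
    apply: le_trans (gauge_subadditive gT (pos0 u) (pos0 v)).
    apply: (gauge_monotone gT) => // i; rewrite !mxE ge_max.
    by rewrite addr_ge0 ?lerD ?le_max ?lexx ?orbT.
  rewrite -(gauge_homogeneous gT) //; congr theta.
  by apply/colP => i; rewrite !mxE maxr_pMr ?mulr0 // ltW.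
have [s [sle st]] := sublinear_support t sp.
exists s; last by rewrite st /= posE.
split=> [i|u u0]; last by have := sle u; rewrite /= posE.
have := sle (- delta_mx i 0); rewrite /= (_ : pos _ = 0) ?gauge0; last first.
  apply/colP => j; rewrite !mxE max_l // oppr_le0; exact: ler0n.
rewrite -[s 0 i]pairing_delta -oppr_le0; apply: le_trans.
by rewrite /pairing -sumrN ler_sum // => j _; rewrite !mxE mulrN.
Qed.

Lemma dual_set_compact : compact dual_set.
Proof.
have cpair t : continuous (fun s : 'rV[R]_K => pairing s t).
  move=> s; apply: continuous_sum_at => i.
  apply: (@continuousM _ _ (fun x : 'rV[R]_K => x 0 i) (fun=> t i 0)).
    exact: coord_continuous.
  exact: cst_continuous.
pose box i : set R := `[0, theta (delta_mx i 0)]%classic.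
apply: (@subclosed_compact _ _
  [set s : 'rV[R]_K | forall i, box i (s 0 i)]%classic).
- have -> : dual_set = (\bigcap_i [set s : 'rV[R]_K | 0 <= s 0 i] `&`
      \bigcap_(t in @orthant R K) [set s | pairing s t <= theta t])%classic.
    by apply/seteqP; split=> s [s0 st]; split=> // i; [move=> _|]; exact: s0.
  apply: closedI; apply: closed_bigI => i _.
    apply: (@preimage_closed _ _ (fun s : 'rV[R]_K => s 0 i)
      [set x | 0 <= x]%classic) (@closed_ge _ 0).
    by move=> s _; exact: coord_continuous.
  apply: (@preimage_closed _ _ (fun s : 'rV[R]_K => pairing s i)
    [set x | x <= theta i]%classic) (@closed_le _ (theta i)).
  by move=> s _; exact: cpair.
- by apply: (@rV_compact _ _ box) => i; exact: segment_compact.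
- move=> s ds i; rewrite /box /= in_itv /= (dual_set_le i ds) andbT.
  by case: ds.
Qed.

Lemma dual_set_midpoint s s' : dual_set s -> dual_set s' ->
  dual_set (2^-1 *: (s + s')).
Proof.
move=> [s0 st] [s'0 s't]; split=> [i|t t0].
  by rewrite !mxE mulr_ge0 ?addr_ge0 ?invr_ge0.
have -> : pairing (2^-1 *: (s + s')) t = 2^-1 * (pairing s t + pairing s' t).
  rewrite /pairing -big_split mulr_sumr; apply: eq_bigr => i _.
  by rewrite !mxE /=; ring.
by have := st t t0; have := s't t t0; lra.
Qed.

End Gauge.

(** * A strongly concave function on an interval *)

Section Twist.
Variable R : realType.
Implicit Types (a b c r L : R).

Lemma ln_le_subr1 r : 0 < r -> ln r <= r - 1.
Proof.
by move=> r0; have := @le_ln1Dx R (r - 1); rewrite subrKC; apply; lra.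
Qed.

Lemma mul_ln_sub_ge a c : 0 < a -> 0 < c -> a - c <= a * (ln a - ln c).
Proof.
move=> a0 c0; have := ln_le_subr1 (divr_gt0 c0 a0).
rewrite ln_div ?posrE // -(ler_pM2l a0).
have -> : a * (c / a - 1) = c - a by field; rewrite gt_eqF.
by rewrite !mulrBr; lra.
Qed.

(** A linear function plus a small multiple of the entropy - r ln r: strongly
    concave in the sense of [twist_midpoint], yet comparable to the identity
    as long as the logarithm stays within [-L, L]. *)
Definition twist L r : R := r * (2 - L^-1 * ln r).

(** The midpoint defect of - r ln r dominates, through ln x <= x - 1 applied to
    square roots, the squared Hellinger distance of a and b, hence their
    chi-square distance. *)
Lemma twist_midpoint_ln L a b : 0 < L -> 0 < a -> 0 < b ->
  (twist L a + twist L b) / 2 + (a - b) ^+ 2 / (a + b) / (8 * L)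
    <= twist L ((a + b) / 2).
Proof.
move=> L0 a0 b0; have m0 : 0 < (a + b) / 2 by lra.
have sqr_pos r : 0 < r -> exists2 x : R, 0 < x & r = x ^+ 2.
  by move=> r0; exists (Num.sqrt r); rewrite ?sqrtr_gt0 // sqr_sqrtr // ltW.
have [x x0 ax] := sqr_pos a a0; have [y y0 bY] := sqr_pos b b0.
have [z z0 mz] := sqr_pos _ m0.
have lnX u : 0 < u -> ln (u ^+ 2) = 2 * ln u.
  by move=> u0; rewrite lnXn // mulr_natl.
have hz : x ^+ 2 + y ^+ 2 = 2 * z ^+ 2 by rewrite -mz -ax -bY; lra.
have hx : x * (x - z) <= x ^+ 2 * (ln x - ln z).
  by rewrite expr2 -mulrA ler_pM2l // mul_ln_sub_ge.
have hy : y * (y - z) <= y ^+ 2 * (ln y - ln z).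
  by rewrite expr2 -mulrA ler_pM2l // mul_ln_sub_ge.
have h1 : (a - b) ^+ 2 / (a + b) <= 2 * (x - y) ^+ 2.
  rewrite ler_pdivrMr ?addr_gt0 // ax bY.
  have -> : (x ^+ 2 - y ^+ 2) ^+ 2 = (x - y) ^+ 2 * (x + y) ^+ 2 by ring.
  have -> : 2 * (x - y) ^+ 2 * (x ^+ 2 + y ^+ 2)
     = (x - y) ^+ 2 * (2 * (x ^+ 2 + y ^+ 2)) by ring.
  by apply: ler_wpM2l; [exact: sqr_ge0|have := sqr_ge0 (x - y); nra].
have h2 : (x - y) ^+ 2 <= 4 * (x * (x - z) + y * (y - z)).
  have -> : 4 * (x * (x - z) + y * (y - z))
    = 2 * ((x - z) ^+ 2 + (y - z) ^+ 2)
      + 2 * (x ^+ 2 + y ^+ 2 - 2 * z ^+ 2) by ring.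
  rewrite hz subrr mulr0 addr0.
  by have := sqr_ge0 ((x - z) + (y - z)); nra.
have h3 : (a - b) ^+ 2 / (a + b) / 8
    <= x ^+ 2 * (ln x - ln z) + y ^+ 2 * (ln y - ln z) by lra.
have -> : twist L ((a + b) / 2) = (twist L a + twist L b) / 2
    + L^-1 * (x ^+ 2 * (ln x - ln z) + y ^+ 2 * (ln y - ln z)).
  rewrite /twist mz ax bY !lnX //.
  have -> : z ^+ 2 = (x ^+ 2 + y ^+ 2) / 2 by lra.
  by field; rewrite gt_eqF.
rewrite lerD2l; have -> : (a - b) ^+ 2 / (a + b) / (8 * L)
    = L^-1 * ((a - b) ^+ 2 / (a + b) / 8).
  by field; rewrite !gt_eqF ?addr_gt0.
by rewrite ler_pM2l ?invr_gt0.
Qed.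

Lemma twist_bounds L r : 0 < L -> 0 < r -> `|ln r| <= L ->
  r <= twist L r <= 3 * r.
Proof.
move=> L0 r0; rewrite ler_norml => /andP[h1 h2].
have h : -1 <= L^-1 * ln r <= 1.
  by rewrite ler_pdivlMl // ler_pdivrMl // mulr1 mulrN1 h1.
rewrite /twist [3 * r]mulrC ler_pM2l // -{1}[r]mulr1 ler_pM2l //; lra.
Qed.

Lemma twist_lipschitz L a b : 2^-1 <= L -> 0 < a -> 0 < b ->
  `|ln a| <= L -> `|ln b| <= L -> `|twist L a - twist L b| <= 5 * `|a - b|.
Proof.
move=> L2; wlog ba : a b / b <= a.
  move=> H a0 b0 ha hb; have [/H|/ltW/H] := leP b a; first exact.
  by rewrite distrC [`|a - b|]distrC; apply.
move=> a0 b0; have L0 : 0 < L by apply: lt_le_trans L2; rewrite invr_gt0.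
rewrite ler_norml => /andP[h1 h2] _.
have h : -1 <= L^-1 * ln a <= 1.
  by rewrite ler_pdivlMl // ler_pdivrMl // mulr1 mulrN1 h1.
have Li : L^-1 <= 2 by rewrite -[2]invrK lef_pV2 // posrE invr_gt0.
have k0 : 0 <= b * (ln a - ln b).
  by rewrite mulr_ge0 ?(ltW b0) // subr_ge0 ler_ln.
have k1 : b * (ln a - ln b) <= a - b.
  by have := mul_ln_sub_ge b0 a0; rewrite !mulrBr; lra.
have -> : twist L a - twist L b
    = (a - b) * (2 - L^-1 * ln a) - L^-1 * (b * (ln a - ln b)).
  by rewrite /twist; ring.
have Lp : 0 < L^-1 by rewrite invr_gt0.
have q0 : 0 <= L^-1 * (b * (ln a - ln b)) by rewrite mulr_ge0 // ltW.
have q1 : L^-1 * (b * (ln a - ln b)) <= 2 * (a - b).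
  by apply: ler_pM => //; exact: ltW.
(* 5 = 3 + 2: the factor 2 - L^-1 ln a lies in [1, 3], and L^-1 <= 2. *)
rewrite [`|a - b|]ger0_norm ?subr_ge0 // ler_norml; nra.
Qed.

(** The defect is expressed in the values of [twist], not in its arguments,
    because these values are the weights that multiply the squared norms. *)
Lemma twist_midpoint L a b : 2^-1 <= L -> 0 < a -> 0 < b ->
  `|ln a| <= L -> `|ln b| <= L ->
  (twist L a + twist L b) / 2
    + (twist L a - twist L b) ^+ 2 / (twist L a + twist L b) / (200 * L)
    <= twist L ((a + b) / 2).
Proof.
move=> L2 a0 b0 ha hb.
have L0 : 0 < L by apply: lt_le_trans L2; rewrite invr_gt0.
apply: le_trans (twist_midpoint_ln L0 a0 b0); rewrite lerD2l.
(* 25 is the square of the Lipschitz constant, and 8 * 25 = 200. *)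
have -> : (a - b) ^+ 2 / (a + b) / (8 * L)
    = 25 * (a - b) ^+ 2 / (a + b) / (200 * L).
  by field; rewrite !gt_eqF ?addr_gt0.
rewrite ler_pM2r ?invr_gt0 ?mulr_gt0 //.
have /andP[ta _] := twist_bounds L0 a0 ha.
have /andP[tb _] := twist_bounds L0 b0 hb.
apply: ler_pM; rewrite ?sqr_ge0 ?invr_ge0 //; first lra.
  have := twist_lipschitz L2 a0 b0 ha hb => h.
  rewrite -real_normK ?num_real // -[(a - b) ^+ 2]real_normK ?num_real //.
  by have := normr_ge0 (twist L a - twist L b); nra.
by rewrite lef_pV2 ?posrE; lra.
Qed.

Lemma twist_continuous L r : 0 < r -> {for r, continuous (twist L)}.
Proof.
move=> r0; apply: continuousM; first exact: cvg_id.
apply: continuousB; first exact: cst_continuous.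
by apply: continuousM; [exact: cst_continuous|exact: continuous_ln].
Qed.

End Twist.

(** * Smoothing a gauge *)

Section Weight.
Variables (R : realType) (K : nat) (theta : 'cV[R]_K -> R).
Hypotheses (K_gt0 : (0 < K)%N) (gT : gauge theta).
Implicit Types (s : 'rV[R]_K) (t u : 'cV[R]_K).

Let L : R := ln (K%:R + 1).
Let a i : R := theta (delta_mx i 0).

(** Dividing by the largest value of the coordinate over the dual set and adding
    1/K confines the argument of [twist] to [1/K, 2], where the logarithm is
    at most ln (K + 1) in absolute value. *)
Definition dual_ratio s i : R := s 0 i / theta (delta_mx i 0) + K%:R^-1.

Definition weight s : 'rV[R]_K :=
  \row_i (theta (delta_mx i 0) * twist (ln (K%:R + 1)) (dual_ratio s i)).

Let K1 : (1 : R) <= K%:R. Proof. by rewrite ler1n. Qed.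
Let a_gt0 i : 0 < a i. Proof. exact: gauge_delta_gt0. Qed.

Lemma ln_succ_ge_half : 2^-1 <= ln (K%:R + 1) :> R.
Proof.
have k1 := K1.
have h : ln 2 <= ln (K%:R + 1) :> R by rewrite ler_ln ?posrE; lra.
apply: le_trans h.
have := @mul_ln_sub_ge R 2 1 (ltr0Sn _ _) ltr01; rewrite ln1; lra.
Qed.

Let L2 : 2^-1 <= L := ln_succ_ge_half.
Let L0 : 0 < L. Proof. by apply: lt_le_trans L2; rewrite invr_gt0. Qed.

Lemma dual_ratio_gt0 s i : dual_set theta s -> 0 < dual_ratio s i.
Proof.
move=> [s0 _]; apply: ltr_wpDl; last by rewrite invr_gt0 ltr0n.
by rewrite divr_ge0 // ltW // a_gt0.
Qed.

Lemma dual_ratio_ln s i : dual_set theta s -> `|ln (dual_ratio s i)| <= L.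
Proof.
move=> ds; have k1 := K1; have r0 := dual_ratio_gt0 i ds.
have hK : 0 < K%:R^-1 :> R by rewrite invr_gt0 ltr0n.
have hK1 : K%:R^-1 <= 1 :> R by rewrite invf_le1 ?ltr0n.
have q0 : 0 <= s 0 i / a i by rewrite divr_ge0 ?(ltW (a_gt0 i)) //; case: ds.
have q1 : s 0 i / a i <= 1 by rewrite ler_pdivrMr // mul1r; exact: dual_set_le.
have Kp : 0 < K%:R + 1 :> R by lra.
have lo : K%:R^-1 <= dual_ratio s i by rewrite lerDr.
have hi : dual_ratio s i <= K%:R + 1 by rewrite /dual_ratio -/(a i); lra.
rewrite ler_norml /L; apply/andP; split; last by rewrite ler_ln ?posrE; lra.
rewrite lerNl -lnV ?posrE // ler_ln ?posrE ?invr_gt0 //.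
by apply: le_trans (_ : K%:R <= _); [rewrite -[leRHS]invrK lef_pV2 ?posrE|lra].
Qed.

Lemma weight_bounds s i : dual_set theta s ->
  s 0 i + a i / K%:R <= weight s 0 i <= 3 * (s 0 i + a i / K%:R).
Proof.
move=> ds; have := twist_bounds L0 (dual_ratio_gt0 i ds) (dual_ratio_ln i ds).
rewrite mxE -/(a i) -/L.
have -> : s 0 i + a i / K%:R = a i * dual_ratio s i.
  by rewrite /dual_ratio mulrDr -/(a i) mulrCA divff ?gt_eqF // mulr1.
by rewrite (mulrCA 3) !ler_pM2l.
Qed.

Lemma weight_gt0 s i : dual_set theta s -> 0 < weight s 0 i.
Proof.
move=> ds; have /andP[+ _] := weight_bounds i ds; apply: lt_le_trans.
by apply: ltr_wpDl; [case: ds|rewrite divr_gt0 ?ltr0n].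
Qed.

Lemma pairing_le_weight s t : dual_set theta s -> orthant t ->
  pairing s t <= pairing (weight s) t.
Proof.
move=> ds t0; apply: ler_sum => i _; apply: ler_wpM2r => //.
have /andP[+ _] := weight_bounds i ds; apply: le_trans.
by rewrite lerDl divr_ge0 // ltW.
Qed.

(** The total cost of the shifts a_i / K is at most theta t, since each a_i t_i
    is the value of theta at a vector below t. *)
Lemma weight_le s t : dual_set theta s -> orthant t ->
  pairing (weight s) t <= 6 * theta t.
Proof.
move=> ds t0.
have h : pairing (weight s) t
    <= 3 * (pairing s t + \sum_(i < K) theta t / K%:R).
  rewrite /pairing -big_split mulr_sumr; apply: ler_sum => i _ /=.
  have /andP[_ h] := weight_bounds i ds.
  apply: le_trans (ler_wpM2r (t0 i) h) _; rewrite -mulrA ler_pM2l //.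
  rewrite mulrDl lerD2l mulrAC ler_pM2r ?invr_gt0 ?ltr0n // mulrC.
  rewrite -(gauge_homogeneous_ge0 gT) //; last exact: orthant_delta.
  apply: (gauge_monotone gT).
    by apply: orthantZ => //; exact: orthant_delta.
  by move=> j; rewrite !mxE andbT; have [->|_] := eqVneq; rewrite ?mulr1 ?mulr0.
rewrite sumr_const card_ord -[_ / _ *+ _]mulr_natr in h.
rewrite mulfVK ?gt_eqF ?ltr0n // in h.
by have := ds.2 t t0; lra.
Qed.

Lemma weight_midpoint s s' t : dual_set theta s -> dual_set theta s' ->
  orthant t ->
  (pairing (weight s) t + pairing (weight s') t) / 2
    + (\sum_i (weight s 0 i - weight s' 0 i) ^+ 2
        / (weight s 0 i + weight s' 0 i) * t i 0) / (200 * L)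
  <= pairing (weight (2^-1 *: (s + s'))) t.
Proof.
move=> ds ds' t0; rewrite /pairing -big_split /= !mulr_suml -big_split /=.
apply: ler_sum => i _.
rewrite -mulrDl (mulrAC _ (t i 0)) (mulrAC _ (t i 0)) -mulrDl.
apply: ler_wpM2r => //.
have rE : dual_ratio (2^-1 *: (s + s')) i
    = (dual_ratio s i + dual_ratio s' i) / 2.
  by rewrite /dual_ratio !mxE; field; rewrite !gt_eqF // ?ltr0n // a_gt0.
rewrite !mxE rE -/(a i) -/L.
have := twist_midpoint L2 (dual_ratio_gt0 i ds) (dual_ratio_gt0 i ds')
  (dual_ratio_ln i ds) (dual_ratio_ln i ds').
set x := twist L _; set y := twist L (dual_ratio s' i); set z := twist L _.
move=> /(ler_wpM2l (ltW (a_gt0 i))) h; apply: le_trans h.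
rewrite le_eqVlt; apply/orP; left; apply/eqP.
have x0 : 0 < x.
  apply: lt_le_trans (dual_ratio_gt0 i ds) _.
  by case/andP: (twist_bounds L0 (dual_ratio_gt0 i ds) (dual_ratio_ln i ds)).
have y0 : 0 < y.
  apply: lt_le_trans (dual_ratio_gt0 i ds') _.
  by case/andP: (twist_bounds L0 (dual_ratio_gt0 i ds') (dual_ratio_ln i ds')).
clearbody x y z; by field; rewrite !gt_eqF ?addr_gt0 ?mulr_gt0 ?a_gt0 //.
Qed.

(** Compactness of the dual set and continuity of the weights. *)
Lemma best_weight t : orthant t ->
  exists2 s, dual_set theta s & forall s', dual_set theta s' ->
    pairing (weight s') t <= pairing (weight s) t.
Proof.
move=> t0; have [s1 ds1 _] := dual_set_attained gT t0.
have [||s sd smax] := @compact_EVT_max _ R (fun s => pairing (weight s) t)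
  _ _ (@dual_set_compact R K theta).
- by exists s1.
- apply: continuous_in_subspaceT => s; rewrite inE => ds.
  apply: continuous_sum_at => i.
  apply: (@continuousM _ _ (fun s => weight s 0 i) (fun=> t i 0));
    last exact: cst_continuous.
  have -> : (fun s => weight s 0 i)
      = (fun s => a i * twist L (dual_ratio s i)).
    by apply/funext => s'; rewrite mxE.
  apply: continuousM; first exact: cst_continuous.
  apply: (@continuous_comp _ _ _ (fun s => dual_ratio s i) (twist L));
    last first.
    exact/twist_continuous/dual_ratio_gt0.
  apply: continuousD; last exact: cst_continuous.
  apply: (@continuousM _ _ (fun s : 'rV[R]_K => s 0 i)).
    exact: coord_continuous.
  exact: cst_continuous.
exists s; first by rewrite inE in sd.
by move=> s' ds'; apply: smax; rewrite inE.
Qed.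

(** The quadratic gain is obtained by comparing the maximizer with the midpoint
    between it and its competitor, which stays in the convex dual set. *)
Lemma gauge_smoothing : exists w : 'cV[R]_K -> 'rV[R]_K,
  [/\ forall t i, orthant t -> 0 < w t 0 i,
      forall t, orthant t -> theta t <= pairing (w t) t <= 6 * theta t
    & forall t u, orthant t -> orthant u ->
        pairing (w u) t + (\sum_i (w t 0 i - w u 0 i) ^+ 2
          / (w t 0 i + w u 0 i) * t i 0) / (100 * L) <= pairing (w t) t].
Proof.
have /choice[f fP] : forall t, exists s, orthant t -> dual_set theta s /\
    forall s', dual_set theta s' ->
      pairing (weight s') t <= pairing (weight s) t.
  move=> t; have [/best_weight[s ds smax]|nt] := pselect (orthant t).
    by exists s.
  by exists 0.
exists (weight \o f); split=> [t i t0|t t0|t u t0 u0] /=.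
- exact/weight_gt0/(fP t t0).1.
- have [ds smax] := fP t t0; rewrite weight_le // andbT.
  have [s' ds' <-] := dual_set_attained gT t0.
  exact: le_trans (pairing_le_weight ds' t0) (smax s' ds').
- have [ds smax] := fP t t0; have [du _] := fP u u0.
  have := weight_midpoint ds du t0.
  have := smax _ (dual_set_midpoint ds du).
  set S := \sum_i _.
  have -> : S / (100 * L) = 2 * (S / (200 * L)) by field; rewrite gt_eqF.
  lra.
Qed.

End Weight.

(** * Norms whose square has quadratic upper bounds *)

Section Differentiation.
Variables (R : realType) (n : nat).
Implicit Types (f : 'cV[R]_n -> R) (x h g : 'cV[R]_n).

(** Convertible to the first-order term in [smooth_norm], with a linear
    structure attached so that it can serve as a differential. *)
Definition inner g h : R := (g^T *m h) 0 0.

Lemma inner_is_linear g : linear (inner g : _ -> R^o).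
Proof. by move=> a u v; rewrite /inner mulmxDr -scalemxAr !mxE. Qed.

HB.instance Definition _ g :=
  GRing.isLinear.Build R 'cV[R]_n R^o _ (inner g) (inner_is_linear g).

Lemma innerN g h : inner g (- h) = - inner g h.
Proof. exact: linearN. Qed.

Lemma innerD g u v : inner g (u + v) = inner g u + inner g v.
Proof. exact: linearD. Qed.

Lemma innerZ g (a : R) h : inner g (a *: h) = a * inner g h.
Proof. exact: linearZ. Qed.

Lemma inner_sumE g h : inner g h = \sum_i g i 0 * h i 0.
Proof. by rewrite /inner mxE; apply: eq_bigr => i _; rewrite mxE. Qed.

Lemma inner_delta g i : inner g (delta_mx i 0) = g i 0.
Proof.
rewrite inner_sumE (bigD1 i) //= big1 ?addr0 ?mxE ?eqxx ?mulr1 // => j ji.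
by rewrite mxE (negbTE ji) mulr0.
Qed.

Lemma inner_continuous g : continuous (inner g).
Proof.
have -> : inner g = fun h => \sum_i g i 0 * h i 0.
  by apply/funext => h; exact: inner_sumE.
move=> h; apply: continuous_sum_at => i.
apply: (@continuousM _ _ (fun=> g i 0) (fun h : 'cV[R]_n => h i 0)).
  exact: cst_continuous.
exact: coord_continuous.
Qed.

Lemma gradient_of_quadratic_remainder f x g (B : R) :
  (forall h, `|f (x + h) - f x - inner g h| <= B * `|h| ^+ 2) ->
  differentiable f x /\ gradient f x = g.
Proof.
move=> rem.
have ex : f \o shift x = cst (f x) + inner g +o_ (0 : 'cV[R]_n) id.
  apply/eqaddoP => _/posnumP[e] /=.
  have d0 : 0 < e%:num / (`|B| + 1) by rewrite divr_gt0 // ltr_wpDl.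
  have := @nbhs0_le R 'cV[R]_n _ d0.
  apply: (@filterS _ (nbhs (0 : 'cV[R]_n))) => h hd.
  rewrite [X in `|X|](_ : _ = f (x + h) - f x - inner g h); last first.
    change (f (h + x) - (f x + inner g h) = f (x + h) - f x - inner g h).
    by rewrite [h + x]addrC opprD addrA.
  apply: le_trans (rem h) _; rewrite expr2 mulrA; apply: ler_wpM2r => //.
  apply: le_trans (_ : (`|B| + 1) * `|h| <= _).
    by apply: ler_wpM2r => //; have := ler_norm B; lra.
  by rewrite mulrC -ler_pdivlMr ?ltr_wpDl.
have dE : 'd f x = inner g :> (_ -> _).
  by apply: diff_unique ex; exact: inner_continuous.
split; last first.
  by apply/colP => i; rewrite mxE dE /= inner_delta.
by apply/diff_locallyP; rewrite dE; split => //; exact: inner_continuous.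
Qed.

End Differentiation.

Section NormTheory.
Variables (R : realType) (n : nat) (N : 'cV[R]_n -> R).
Hypothesis nN : is_norm N.

Lemma is_normD x y : N (x + y) <= N x + N y. Proof. by case: nN. Qed.

Lemma is_normZ (a : R) x : N (a *: x) = `|a| * N x. Proof. by case: nN. Qed.

Lemma is_norm0 : N 0 = 0.
Proof. by rewrite -(scale0r (0 : 'cV[R]_n)) is_normZ normr0 mul0r. Qed.

Lemma is_normN x : N (- x) = N x.
Proof. by rewrite -scaleN1r is_normZ normrN normr1 mul1r. Qed.

Lemma is_norm_ge0 x : 0 <= N x.
Proof. by have := is_normD x (- x); rewrite subrr is_norm0 is_normN; lra. Qed.

Lemma is_norm_sum (I : finType) (F : I -> 'cV[R]_n) :
  N (\sum_i F i) <= \sum_i N (F i).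
Proof.
apply: (big_ind2 (fun u x => N u <= x)) => // [|u x v y ux vy].
  by rewrite is_norm0.
exact: le_trans (is_normD u v) (lerD ux vy).
Qed.

Lemma cV_coord_le (h : 'cV[R]_n) i : `|h i 0| <= `|h|.
Proof.
rewrite [leRHS]/Num.norm /= mx_normrE; apply/bigmax_geP; right.
by exists (i, 0).
Qed.

Lemma cV_norm_le (h : 'cV[R]_n) (B : R) : 0 <= B ->
  (forall i, `|h i 0| <= B) -> `|h| <= B.
Proof.
move=> B0 hB; rewrite [leLHS]/Num.norm /= mx_normrE; apply/bigmax_leP.
by split=> // -[i j] _ /=; rewrite ord1.
Qed.

Lemma is_norm_le_sup : exists2 C : R, 0 < C &
  (forall h, N h <= C * `|h|) /\ (forall i, N (delta_mx i 0) <= C).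
Proof.
have s0 : 0 <= \sum_i N (delta_mx i 0).
  by apply: sumr_ge0 => i _; exact: is_norm_ge0.
exists (1 + \sum_i N (delta_mx i 0)); first lra.
split=> [h|i]; last first.
  rewrite (bigD1 i) //= addrA addrAC lerDr addr_ge0 //.
  by apply: sumr_ge0 => j _; exact: is_norm_ge0.
rewrite {1}(matrix_sum_delta h); apply: le_trans (is_norm_sum _) _.
rewrite mulrDl mul1r mulr_suml; apply: ler_wpDl => //; apply: ler_sum => i _.
rewrite big_ord1 is_normZ mulrC; apply: ler_wpM2l; first exact: is_norm_ge0.
exact: cV_coord_le.
Qed.

(** Convexity, applied at x + h and x - h, reflects the upper bound into a
    lower one, so that g x is the gradient at x; the two bounds together make
    the gradient Lipschitz. *)
Lemma smooth_norm_of_upper_quadratic (kappa : R) : 1 <= kappa ->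
  (forall x, exists g, forall h,
     N (x + h) ^+ 2 <= N x ^+ 2 + inner g h + kappa * N h ^+ 2) ->
  smooth_norm kappa N.
Proof.
move=> k1 /choice[g up].
have k0 : 0 < kappa by lra.
have [C C0 [NC NeC]] := is_norm_le_sup.
have N0 := is_norm_ge0.
have lo x h : N x ^+ 2 + inner (g x) h - kappa * N h ^+ 2 <= N (x + h) ^+ 2.
  have := up x (- h); rewrite is_normN innerN.
  have : 2 * N x ^+ 2 <= N (x + h) ^+ 2 + N (x - h) ^+ 2.
    have h1 : 2 * N x <= N (x + h) + N (x - h).
      have -> : 2 * N x = N ((x + h) + (x - h)).
        rewrite addrACA subrr addr0 -mulr2n -[x *+ 2]scaler_nat.
        by rewrite is_normZ normr_nat.
      exact: is_normD.
    have h2 : (2 * N x) ^+ 2 <= (N (x + h) + N (x - h)) ^+ 2.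
      by rewrite ler_pXn2r ?nnegrE ?addr_ge0 ?mulr_ge0 ?N0.
    have := sqr_ge0 (N (x + h) - N (x - h)); lra.
  lra.
have gradE x : differentiable (fun y => N y ^+ 2) x /\
    gradient (fun y => N y ^+ 2) x = g x.
  apply: (@gradient_of_quadratic_remainder _ _ _ _ _ (kappa * C ^+ 2)) => h.
  have h2 : kappa * N h ^+ 2 <= kappa * C ^+ 2 * `|h| ^+ 2.
    rewrite -mulrA ler_pM2l // -exprMn ler_pXn2r ?nnegrE ?N0 //.
    by rewrite mulr_ge0 // ltW.
  have := up x h; have := lo x h.
  by rewrite ler_norml; lra.
split=> //; last by move=> x h; rewrite (gradE x).2; exact: up.
split=> [x|x]; first exact: (gradE x).1.
have -> : gradient (fun y => N y ^+ 2) = g.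
  by apply/funext => y; exact: (gradE y).2.
have lip y : `|g x - g y| <= 6 * kappa * C ^+ 2 * `|x - y|.
  (* Probing with increments of the size of y - x makes every quadratic error
     of order tau^2, against a linear term of order tau. *)
  pose tau := `|y - x|.
  have [->|xy] := eqVneq x y; first by rewrite !subrr normr0 mulr0.
  have tau0 : 0 < tau by rewrite normr_gt0 subr_eq0 eq_sym.
  have key (h : 'cV[R]_n) : N h <= C * tau ->
      inner (g y) h - inner (g x) h <= 6 * kappa * C ^+ 2 * tau ^+ 2.
    move=> hh; have NyxC : N (y - x) <= C * tau by exact: NC.
    have e1 := lo y h; have e2 := up x ((y - x) + h); have e3 := lo x (y - x).
    rewrite addrA subrKC in e2 e3.
    rewrite innerD in e2.
    have e4 : N (y - x + h) <= 2 * (C * tau) by have := is_normD (y - x) h; lra.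
    have sq u (c : R) : N u <= c -> kappa * N u ^+ 2 <= kappa * c ^+ 2.
      move=> uc; rewrite ler_pM2l // ler_pXn2r ?nnegrE //.
      exact: le_trans (N0 u) uc.
    have := sq _ _ hh; have := sq _ _ NyxC; have := sq _ _ e4.
    rewrite !exprMn; lra.
  apply: cV_norm_le => [|i].
    by rewrite !mulr_ge0 ?sqr_ge0 // ltW.
  have Ni : N (tau *: delta_mx i 0) <= C * tau.
    by rewrite is_normZ gtr0_norm // mulrC ler_pM2r.
  have := key _ Ni; have := key (- (tau *: delta_mx i 0)).
  rewrite is_normN => /(_ Ni).
  rewrite !innerN !innerZ !inner_delta distrC -/tau !mxE => h1 h2.
  rewrite -(ler_pM2r tau0) (_ : _ * tau * tau = 6 * kappa * C ^+ 2 * tau ^+ 2);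
    last by ring.
  rewrite -[in leLHS](gtr0_norm tau0) -normrM.
  rewrite ler_norml; move: h1 h2; lra.
apply/(@cvgrPdist_le R 'cV[R]_n _ _ (@nbhs_filter 'cV[R]_n x)) => e e0.
have L0 : 0 < 6 * kappa * C ^+ 2 by rewrite !mulr_gt0 // exprn_gt0.
apply/(@nbhs_normP R 'cV[R]_n); exists ((6 * kappa * C ^+ 2)^-1 * e) => /=.
  by rewrite mulr_gt0 ?invr_gt0.
move=> y /ltW; rewrite ler_pdivlMl // => xy; exact: le_trans (lip y) xy.
Qed.

End NormTheory.

(** * Aggregated norms *)

Section SupportGauge.
Variables (R : realType) (K : nat).
Variable w : 'cV[R]_K -> 'rV[R]_K.
Implicit Types t u : 'cV[R]_K.
Hypotheses (w_gt0 : forall t i, orthant t -> 0 < w t 0 i)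
  (w_max : forall t u, orthant t -> orthant u ->
    pairing (w u) t <= pairing (w t) t).

(** By [w_max] this function is a pointwise maximum of linear forms with positive
    coefficients. *)
Lemma gauge_of_best_weight : gauge (fun t => pairing (w t) t).
Proof.
have le_hom (a : R) t : 0 < a -> orthant t ->
    pairing (w (a *: t)) (a *: t) <= a * pairing (w t) t.
  move=> a0 t0; rewrite pairingZr ler_pM2l //; apply: w_max => //.
  exact: orthantZ (ltW a0) t0.
split=> [t u t0 u0|a t a0 t0|t u t0 tu|t t0 tN0].
- rewrite pairingDr.
  by apply: lerD; apply: w_max => //; exact: orthantD.
- apply/eqP; rewrite eq_le le_hom //=.
  have := le_hom a^-1 (a *: t).
  rewrite invr_gt0 scalerA mulVf ?gt_eqF // scale1r.
  by rewrite ler_pdivlMl //; apply => //; exact: orthantZ (ltW a0) t0.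
- have u0 : orthant u by move=> i; exact: le_trans (t0 i) (tu i).
  apply: le_trans (w_max u0 t0); apply: ler_sum => i _.
  by rewrite ler_pM2l // w_gt0.
- rewrite lt_neqAle eq_sym; apply/andP; split; last first.
    by apply: sumr_ge0 => i _; rewrite mulr_ge0 // ltW // w_gt0.
  apply: contra_not_neq tN0 => /eqP; rewrite psumr_eq0; last first.
    by move=> i _; rewrite mulr_ge0 // ltW // w_gt0.
  move=> /allP s0; apply/colP => i; rewrite mxE.
  have := s0 i (mem_index_enum i); rewrite /= mulf_eq0 gt_eqF ?w_gt0 //=.
  by move/eqP.
Qed.

End SupportGauge.

Section Aggregate.
Variables (R : realType) (K : nat) (n : 'I_K -> nat).
Implicit Types (theta : 'cV[R]_K -> R) (x y h : 'cV[R]_(\sum_i n i)).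
Implicit Types N M : forall i, 'cV[R]_(n i) -> R.

Definition block_squares N x : 'cV[R]_K := \col_i N i (submxcol x i) ^+ 2.

Lemma orthant_block_squares N x : orthant (block_squares N x).
Proof. by move=> i; rewrite mxE sqr_ge0. Qed.
#[local] Hint Resolve orthant_block_squares : core.

Lemma submxcolZ (a : R) x i : submxcol (a *: x) i = a *: submxcol x i.
Proof. by apply/matrixP => j k; rewrite /submxcol !mxE. Qed.

Lemma sqr_aggregated_norm theta N x : gauge theta ->
  aggregated_norm theta N x ^+ 2 = theta (block_squares N x).
Proof.
move=> gT; rewrite sqr_sqrtr //.
by apply: (gauge_ge0 gT); exact: (orthant_block_squares N x).
Qed.

Lemma aggregated_norm_le theta N x (c : R) : gauge theta -> 0 <= c ->
  theta (block_squares N x) <= c ^+ 2 -> aggregated_norm theta N x <= c.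
Proof.
move=> gT c0 h; rewrite -(ler_pXn2r (n := 2)) ?nnegrE ?sqrtr_ge0 //.
by rewrite sqr_aggregated_norm.
Qed.

(** For the triangle inequality, with p and q the norms of x and y, weigh
    (u + v)^2 <= (1 + q/p) u^2 + (1 + p/q) v^2 in every block and apply
    subadditivity: the right-hand side becomes (p + q)^2. *)
Lemma aggregated_norm_is_norm theta N : gauge theta ->
  (forall i, is_norm (N i)) -> is_norm (aggregated_norm theta N).
Proof.
move=> gT nN; set A := aggregated_norm theta N.
have A0 x : 0 <= A x by exact: sqrtr_ge0.
have Asq x : A x ^+ 2 = theta (block_squares N x) by exact: sqr_aggregated_norm.
have Aeq0 x : A x = 0 -> x = 0.
  move=> Ax0; apply/mxcolP => i; rewrite submxcol0.
  have := Asq x; rewrite Ax0 expr0n /=.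
  move=> /esym/(gauge_eq0 gT (orthant_block_squares N x)).
  move=> /matrixP/(_ i 0); rewrite !mxE => /eqP; rewrite sqrf_eq0 => /eqP.
  by case: (nN i) => _ _; apply.
have Agt0 x : x <> 0 -> 0 < A x.
  by move=> x0; rewrite lt_neqAle A0 andbT eq_sym; apply/eqP => /Aeq0.
split=> [x y|a x|//]; last first.
  rewrite /A /aggregated_norm.
  have -> : \col_i N i (submxcol (a *: x) i) ^+ 2 = a ^+ 2 *: block_squares N x.
    apply/colP => i; rewrite !mxE submxcolZ is_normZ // exprMn.
    by rewrite real_normK // num_real.
  rewrite (gauge_homogeneous_ge0 gT) ?sqr_ge0 // sqrtrM ?sqr_ge0 //.
  by rewrite sqrtr_sqr.
have [->|/Agt0 ax] := pselect (x = 0); first by rewrite add0r lerDr.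
have [->|/Agt0 ay] := pselect (y = 0); first by rewrite addr0 lerDl.
apply: aggregated_norm_le => //; first exact: addr_ge0.
set p := A x; set q := A y.
have q0 : 0 <= q / p by apply: divr_ge0; exact: A0.
have p0 : 0 <= p / q by apply: divr_ge0; exact: A0.
apply: le_trans (_ : (1 + q / p) * p ^+ 2 + (1 + p / q) * q ^+ 2 <= _);
  last first.
  by rewrite le_eqVlt; apply/orP; left; apply/eqP; field; rewrite !gt_eqF.
rewrite !Asq -!(gauge_homogeneous_ge0 gT) ?addr_ge0 //.
apply: le_trans (gauge_subadditive gT _ _);
  try by apply: orthantZ; rewrite ?addr_ge0.
apply: (gauge_monotone gT) => // i; rewrite !mxE submxcolD.
set u := N i (submxcol x i); set v := N i (submxcol y i).
apply: le_trans (_ : (u + v) ^+ 2 <= _).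
  rewrite ler_pXn2r ?nnegrE ?addr_ge0 ?is_norm_ge0 //; exact: is_normD.
have h : 2 * (u * v) <= q / p * u ^+ 2 + p / q * v ^+ 2.
  rewrite -subr_ge0 (_ : _ - _ = (q * u - p * v) ^+ 2 / (p * q)).
    by rewrite divr_ge0 ?sqr_ge0 ?mulr_ge0 ?(ltW ax) ?(ltW ay).
  by field; rewrite !gt_eqF.
by lra.
Qed.

Lemma aggregated_norm_mono theta N M (c : R) x : gauge theta -> 0 <= c ->
  (forall i (y : 'cV_(n i)), 0 <= N i y <= c * M i y) ->
  aggregated_norm theta N x <= c * aggregated_norm theta M x.
Proof.
move=> gT c0 NM; apply: aggregated_norm_le => //.
  by rewrite mulr_ge0 ?sqrtr_ge0.
rewrite exprMn sqr_aggregated_norm // -(gauge_homogeneous_ge0 gT) ?sqr_ge0 //.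
apply: (gauge_monotone gT) => // i; rewrite !mxE -exprMn.
have /andP[N0 h] := NM i (submxcol x i).
by rewrite ler_pXn2r ?nnegrE // (le_trans N0).
Qed.

End Aggregate.
#[local] Hint Resolve orthant_block_squares : core.

(** Smoothness at the increments - e v bounds the directional derivative by the
    decrease of the squared norm, which is at most 2 e N x N v; let e tend
    to 0. *)
Lemma gradient_sqr_norm_le (R : realType) (n : nat) (N : 'cV[R]_n -> R)
    (kappa : R) (x h : 'cV[R]_n) : smooth_norm kappa N ->
  `|inner (gradient (fun y => N y ^+ 2) x) h| <= 2 * N x * N h.
Proof.
move=> [k1 nN _ up]; have N0 := is_norm_ge0 nN.
suff half v : inner (gradient (fun y => N y ^+ 2) x) v <= 2 * N x * N v.
  rewrite ler_norml half andbT lerNl -innerN.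
  by apply: le_trans (half _) _; rewrite is_normN.
set d := inner _ v.
have step (e : R) : 0 < e -> d <= 2 * N x * N v + kappa * e * N v ^+ 2.
  move=> e0; have := up x (- (e *: v)); rewrite -/(inner _ _) innerN innerZ -/d.
  rewrite is_normN // is_normZ // gtr0_norm // => h1.
  have h2 : N x <= N (x - e *: v) + e * N v.
    have := is_normD nN (x - e *: v) (e *: v).
    by rewrite subrK is_normZ // gtr0_norm.
  rewrite -(ler_pM2l e0).
  have := N0 (x - e *: v); have := N0 x; have := N0 v => v0 x0 z0.
  have ev0 : 0 <= e * N v by rewrite mulr_ge0 // ltW.
  have h3 : N x ^+ 2 - 2 * N x * (e * N v) <= N (x - e *: v) ^+ 2.
    move: h2 z0 ev0; move: (N (x - _)) (e * N v) => z c.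
    move: (N x) x0 => b b0 bzc z0 c0.
    have [bc|cb] := leP b c.
      by apply: le_trans (sqr_ge0 z); rewrite subr_le0 expr2; nra.
    have : (b - c) ^+ 2 <= z ^+ 2 by rewrite ler_pXn2r ?nnegrE //; lra.
    by have := sqr_ge0 c; lra.
  nra.
apply/ler_addgt0Pr => e e0.
have k0 : 0 < kappa * N v ^+ 2 + 1.
  by rewrite ltr_wpDl ?mulr_ge0 ?sqr_ge0 //; lra.
apply: le_trans (step _ (divr_gt0 e0 k0)) _; rewrite lerD2l.
rewrite mulrAC mulrA ler_pdivrMr // mulrC ler_pM2l //; lra.
Qed.

(** * Smoothness of the aggregated norm *)

Lemma smooth_norm_weaken (R : realType) n (k k' : R) (N : 'cV[R]_n -> R) :
  k <= k' -> smooth_norm k N -> smooth_norm k' N.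
Proof.
move=> kk' [k1 nN cd up]; split=> //; first exact: le_trans kk'.
move=> x h; apply: le_trans (up x h) _.
by rewrite lerD2l ler_wpM2r ?sqr_ge0.
Qed.

Section Mixture.
Variables (R : realType) (K : nat) (n : 'I_K -> nat).
Variable M : forall i, 'cV[R]_(n i) -> R.
Variable w : 'cV[R]_K -> 'rV[R]_K.
Variables kappa c : R.
Hypotheses (c_gt0 : 0 < c) (M_smooth : forall i, smooth_norm kappa (@M i))
  (kappa1 : 1 <= kappa)
  (w_gt0 : forall t i, orthant t -> 0 < w t 0 i)
  (w_max : forall t u, orthant t -> orthant u ->
    pairing (w u) t + c * (\sum_i (w t 0 i - w u 0 i) ^+ 2
      / (w t 0 i + w u 0 i) * t i 0) <= pairing (w t) t).

Let F t := pairing (w t) t.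

Lemma best_weight_max t u : orthant t -> orthant u -> pairing (w u) t <= F t.
Proof.
move=> t0 u0; apply: le_trans (w_max t0 u0).
rewrite lerDl mulr_ge0 ?(ltW c_gt0) //; apply: sumr_ge0 => i _.
by rewrite mulr_ge0 // divr_ge0 ?sqr_ge0 // ltW // addr_gt0 // w_gt0.
Qed.

Lemma best_weight_gauge : gauge F.
Proof. exact: gauge_of_best_weight w_gt0 best_weight_max. Qed.

Let block_gradient x : 'cV[R]_(\sum_i n i) :=
  \mxcol_i (w (block_squares M x) 0 i
            *: gradient (fun y => M y ^+ 2) (submxcol x i)).

Lemma inner_block_gradient x h : inner (block_gradient x) h =
  \sum_i w (block_squares M x) 0 i
    * inner (gradient (fun y => M y ^+ 2) (submxcol x i)) (submxcol h i).
Proof.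
rewrite {1}/inner tr_mxcol -{1}(submxcolK h) mul_mxrow_mxcol summxE.
apply: eq_bigr => i _.
by rewrite linearZ -scalemxAl mxE.
Qed.

(** Between x and x + h the optimal weights move from w t to w u.  The linear
    term with the new weights differs from the one with the old weights by
    at most 2 |w u - w t| M x M h per block, and the quadratic gain of the
    maximizer absorbs this by the arithmetic-geometric mean inequality. *)
Lemma aggregated_norm_smooth :
  smooth_norm (kappa + 2 / c) (aggregated_norm F M).
Proof.
have gF := best_weight_gauge.
apply: smooth_norm_of_upper_quadratic.
- by apply: aggregated_norm_is_norm => // i; case: (M_smooth i).
- by rewrite ler_wpDr // divr_ge0 // ltW.
move=> x; exists (block_gradient x) => h.
rewrite !sqr_aggregated_norm // inner_block_gradient.
set t := block_squares M x; set u := block_squares M (x + h).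
set v := block_squares M h.
have t0 : orthant t by exact: orthant_block_squares.
have u0 : orthant u by exact: orthant_block_squares.
have v0 : orthant v by exact: orthant_block_squares.
pose d i := inner (gradient (fun y => M y ^+ 2) (submxcol x i)) (submxcol h i).
have coord i : w u 0 i * u i 0 <= w u 0 i * t i 0
    + c * ((w t 0 i - w u 0 i) ^+ 2 / (w t 0 i + w u 0 i) * t i 0)
    + w t 0 i * d i + (kappa * (w u 0 i * v i 0)
    + c^-1 * (w t 0 i * v i 0 + w u 0 i * v i 0)).
  have wt := w_gt0 i t0; have wu := w_gt0 i u0.
  have [_ nM _ up] := M_smooth i.
  have := up (submxcol x i) (submxcol h i).
  have := gradient_sqr_norm_le (submxcol x i) (submxcol h i) (M_smooth i).
  rewrite -[(_ *m _) 0 0]/(d i) -/(d i) -submxcolD.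
  rewrite !mxE; set p := M (submxcol x i); set q := M (submxcol h i).
  set r := M (submxcol (x + h) i); move: (w t 0 i) (w u 0 i) wt wu => a b a0 b0.
  have p0 : 0 <= p by exact: is_norm_ge0.
  have q0 : 0 <= q by exact: is_norm_ge0.
  move: (d i) p q r p0 q0 => e p q r p0 q0 he hr.
  have h1 : (b - a) * e <= c * ((a - b) ^+ 2 / (a + b) * p ^+ 2)
      + c^-1 * ((a + b) * q ^+ 2).
    apply: le_trans (ler_norm _) _; rewrite normrM.
    apply: le_trans (ler_wpM2l (normr_ge0 _) he) _.
    rewrite -subr_ge0 -[(a - b) ^+ 2]real_normK ?num_real // distrC.
    move: `|b - a| => D.
    rewrite (_ : _ - _ = (c * D * p - (a + b) * q) ^+ 2 / (c * (a + b))).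
      by rewrite divr_ge0 ?sqr_ge0 // ltW // mulr_gt0 // addr_gt0.
    by field; rewrite !gt_eqF // addr_gt0.
  have h2 : b * r ^+ 2 <= b * (p ^+ 2 + e + kappa * q ^+ 2) by rewrite ler_pM2l.
  lra.
have tot : F u <= pairing (w u) t
   + c * (\sum_i (w t 0 i - w u 0 i) ^+ 2 / (w t 0 i + w u 0 i) * t i 0)
   + \sum_i w t 0 i * d i
   + (kappa * pairing (w u) v + c^-1 * (pairing (w t) v + pairing (w u) v)).
  rewrite /F /pairing -!big_split /= !mulr_sumr -!big_split /=.
  by apply: ler_sum => i _; exact: coord.
have kappa0 : 0 <= kappa by move: kappa1; lra.
have cu := best_weight_max v0 u0; have ct := best_weight_max v0 t0.
have opt := w_max t0 u0.
have k1 : kappa * pairing (w u) v <= kappa * F v by apply: ler_wpM2l.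
have k2 : c^-1 * (pairing (w t) v + pairing (w u) v) <= c^-1 * (2 * F v).
  by rewrite ler_pM2l ?invr_gt0 //; lra.
move: tot opt; rewrite -/(F t) -/(F v); lra.
Qed.

End Mixture.

Theorem theorem2p1 (R : realType) :
  exists c1 c2 : R, [/\ 0 < c1, 0 < c2 &
    forall (K : nat) (theta : 'cV[R]_K -> R) (kappa sigma : R)
           (n : 'I_K -> nat) (N : forall i : 'I_K, 'cV[R]_(n i) -> R),
      (1 <= K)%N -> aggregator theta -> 1 <= kappa -> 1 <= sigma ->
      (forall i, regular_norm kappa sigma (N i)) ->
      regular_norm (c1 * (ln (K%:R + 1) + kappa)) (c2 * sigma)
        (aggregated_norm theta N)].
Proof.
(* 200 L is 2 / c for the gain c = (100 L)^-1, and 3 exceeds the square root of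
   the distortion 6 of theta. *)
exists 200, 3; split=> // K theta kappa sigma n N K_gt0 /aggregator_gauge gT.
move=> k1 s1 rN.
have [w [w_gt0 w_le w_max]] := gauge_smoothing K_gt0 gT.
have L2 := ln_succ_ge_half R K_gt0.
set L := ln (K%:R + 1) in L2 w_max *.
have L0 : 0 < L by lra.
have exM i : exists2 M : 'cV[R]_(n i) -> R, smooth_norm kappa M
    & forall x, sigma^-1 * M x <= N i x <= sigma * M x by case: (rN i).
pose M i := s2val (cid2 (exM i)).
have M_smooth i : smooth_norm kappa (M i) by exact: s2valP (cid2 (exM i)).
have MN i x : sigma^-1 * M i x <= N i x <= sigma * M i x.
  exact: s2valP' (cid2 (exM i)) x.
have nM i : is_norm (M i) by case: (M_smooth i).
have nN i : is_norm (N i) by case: (rN i).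
pose F t := pairing (w t) t.
have c0 : 0 < (100 * L)^-1 by rewrite invr_gt0 mulr_gt0.
have w_max' t u : orthant t -> orthant u -> pairing (w u) t + (100 * L)^-1 *
    (\sum_i (w t 0 i - w u 0 i) ^+ 2 / (w t 0 i + w u 0 i) * t i 0)
    <= pairing (w t) t.
  by rewrite mulrC; exact: w_max.
have gF : gauge F by exact: best_weight_gauge c0 w_gt0 w_max'.
have s0 : 0 < sigma by lra.
have lower x : aggregated_norm theta M x <= aggregated_norm F M x.
  apply: aggregated_norm_le => //; first exact: sqrtr_ge0.
  rewrite sqr_aggregated_norm //.
  by case/andP: (w_le _ (orthant_block_squares M x)).
have upper x : aggregated_norm F M x <= 3 * aggregated_norm theta M x.
  apply: aggregated_norm_le => //; first by rewrite mulr_ge0 ?sqrtr_ge0.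
  have ox := orthant_block_squares M x; rewrite exprMn sqr_aggregated_norm //.
  have /andP[_ h] := w_le _ ox; apply: le_trans h _.
  by have := gauge_ge0 gT ox; lra.
split.
- lra.
- lra.
- exact: aggregated_norm_is_norm.
exists (aggregated_norm F M).
  apply: smooth_norm_weaken
    (aggregated_norm_smooth c0 M_smooth k1 w_gt0 w_max').
  rewrite invrK; lra.
move=> x.
have hNM : aggregated_norm theta N x <= sigma * aggregated_norm theta M x.
  apply: aggregated_norm_mono => //; first exact: ltW.
  by move=> i y; rewrite is_norm_ge0 //=; case/andP: (MN i y).
have hMN : aggregated_norm theta M x <= sigma * aggregated_norm theta N x.
  apply: aggregated_norm_mono => //; first exact: ltW.
  move=> i y; rewrite is_norm_ge0 //= -ler_pdivrMl //.
  by case/andP: (MN i y).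
have A0 : 0 <= aggregated_norm theta M x by exact: sqrtr_ge0.
have B0 : 0 <= aggregated_norm F M x by exact: sqrtr_ge0.
apply/andP; split.
  rewrite ler_pdivrMl ?mulr_gt0 //; apply: le_trans (upper x) _.
  by rewrite -mulrA ler_pM2l.
apply: le_trans hNM _.
by apply: ler_pM => //; rewrite ?(ltW s0) //; lra.
Qed.
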